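(* Let $\Delta$ be a finite simplicial complex on $V=\{x_1,\dots,x_n\}$, and let $\chi$ be any $s$-colouring of $\Delta$. Then the $h$-vector of $\Delta_\chi$ is precisely the $f$-vector of $\Delta$ (up to trailing zeros): if $\dim\Delta=d$, then $h_i(\Delta_\chi)=f_{i-1}(\Delta)$ for $0\le i\le d+1$, and $h_i(\Delta_\chi)=0$ for all other $i$.
   Context: A finite simplicial complex $\Delta$ on a finite vertex set $V$ is a collection of subsets (faces) of $V$ closed under taking subsets and containing $\emptyset$; facets are the inclusion-maximal faces. A face $\sigma$ has dimension $|\sigma|-1$, and $\dim\Delta$ is the maximum dimension of a face. If $\dim\Delta=d$, then $f(\Delta)=(f_{-1},f_0,\dots,f_d)$ with $f_i$ the number of faces of dimension $i$, and $h(\Delta)=(h_0,\dots,h_{d+1})$ with $h_k=\sum_{i=0}^k(-1)^{k-i}\binom{d+1-i}{k-i}f_{i-1}$. An $s$-colouring $\chi$ of $\Delta$ is a partition $V=V_1\cup\dots\cup V_s$ into pairwise disjoint, possibly empty sets with $|F\cap V_j|\le1$ for every facet $F$ and every $1\le j\le s$. $\Delta_\chi$ is the simplicial complex on $\{x_1,\dots,x_n,y_1,\dots,y_s\}$ (with $y_1,\dots,y_s$ new vertices) whose faces are the sets $\sigma\cup\tau$ with $\sigma\in\Delta$, $\tau\subseteq\{y_1,\dots,y_s\}$, and $\sigma\cap V_j=\emptyset$ for all $y_j\in\tau$. *)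

(* Defs.v *)
From HB Require Import structures.
From mathcomp Require Import all_boot all_order all_algebra.

Set Implicit Arguments.
Unset Strict Implicit.
Unset Printing Implicit Defensive.

Import Order.TTheory GRing.Theory Num.Theory.

Local Open Scope ring_scope.

(* Singletons are not required to be faces. *)
Record simplicial_complex (V : finType) := SimplicialComplex {
  faces :> {set {set V}};
  faces_set0 : set0 \in faces;
  faces_subset : forall F G : {set V}, F \in faces -> G \subset F -> G \in faces
}.

Definition facet (V : finType) (D : simplicial_complex V) (F : {set V}) : bool :=
  maxset (fun G => G \in faces D) F.

Definition face_dim (V : finType) (F : {set V}) : int := #|F|%:Z - 1.

(* The default value -1 is the dimension of the face set0, which always belongs
   to D, so this is the maximum of the dimensions of the faces. *)
Definition complex_dim (V : finType) (D : simplicial_complex V) : int :=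
  \big[Num.max/-1]_(F in faces D) face_dim F.

Definition fnum (V : finType) (D : simplicial_complex V) (i : int) : nat :=
  #|[set F in faces D | face_dim F == i]|.

(* complex_dim D >= -1, so absz only turns complex_dim D + 1 into a nat.  The
   truncated subtractions are exact for i <= k <= complex_dim D + 1, and for
   larger k every term vanishes. *)
Definition hnum (V : finType) (D : simplicial_complex V) (k : nat) : int :=
  \sum_(0 <= i < k.+1)
     (-1) ^+ (k - i) * 'C(absz (complex_dim D + 1) - i, k - i)%:Z
       * (fnum D (i%:Z - 1))%:Z.

(* (f_{-1}, ..., f_d) and (h_0, ..., h_{d+1}), both of length d + 2. *)
Definition fvector (V : finType) (D : simplicial_complex V) : seq int :=
  mkseq (fun i : nat => (fnum D (i%:Z - 1))%:Z) (absz (complex_dim D + 2)).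

Definition hvector (V : finType) (D : simplicial_complex V) : seq int :=
  mkseq (hnum D) (absz (complex_dim D + 2)).

(* The classes may be empty, so this is not [partition] from finset. *)
Definition colouring (V : finType) (D : simplicial_complex V) (s : nat)
    (chi : 'I_s -> {set V}) : Prop :=
  [/\ \bigcup_(j < s) chi j = [set: V],
      forall i j : 'I_s, i != j -> [disjoint chi i & chi j]
    & forall (F : {set V}) (j : 'I_s), facet D F -> (#|F :&: chi j| <= 1)%N].

(* The vertex y_j is [inr j]. *)
Definition colour_faces (V : finType) (D : simplicial_complex V) (s : nat)
    (chi : 'I_s -> {set V}) : {set {set V + 'I_s}} :=
  [set (inl @: S) :|: (inr @: T) | S : {set V} in faces D,
     T : {set 'I_s} in [set T : {set 'I_s} | [forall j in T, S :&: chi j == set0]]].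

Lemma colour_faces_set0 (V : finType) (D : simplicial_complex V) (s : nat)
    (chi : 'I_s -> {set V}) : set0 \in colour_faces D chi.
Proof.
apply/imset2P; exists set0 set0; rewrite ?faces_set0 ?imset0 ?setU0 //.
by rewrite inE; apply/forall_inP => j; rewrite inE.
Qed.

Lemma colour_faces_subset (V : finType) (D : simplicial_complex V) (s : nat)
    (chi : 'I_s -> {set V}) (F G : {set V + 'I_s}) :
  F \in colour_faces D chi -> G \subset F -> G \in colour_faces D chi.
Proof.
case/imset2P=> S T SD; rewrite inE => /forall_inP ST -> {F} /subsetP GF.
have GS : inl @^-1: G \subset S.
  apply/subsetP=> x; rewrite inE => /GF /setUP[] /imsetP[y yS] //.
  by case=> ->.
apply/imset2P; exists (inl @^-1: G) (inr @^-1: G).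
- exact: faces_subset SD GS.
- rewrite inE; apply/forall_inP => j; rewrite inE => /GF /setUP[] /imsetP[y yT] //.
  case=> ->; rewrite -subset0 -(eqP (ST y yT)); exact: setSI.
apply/setP=> -[x|j]; rewrite inE.
- rewrite mem_imset ?inE; last by move=> ? ? [].
  by case: imsetP => [[]|] //; rewrite orbF.
- rewrite [X in _ || X]mem_imset ?inE; last by move=> ? ? [].
  by case: imsetP => [[]|].
Qed.

Definition colour_complex (V : finType) (D : simplicial_complex V) (s : nat)
    (chi : 'I_s -> {set V}) : simplicial_complex (V + 'I_s)%type :=
  SimplicialComplex (colour_faces_set0 D chi) (@colour_faces_subset V D s chi).

(* Main.v *)
Require Import Defs.
From HB Require Import structures.
From mathcomp Require Import all_boot all_order all_algebra.
From mathcomp Require Import zify ring.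

Set Implicit Arguments.
Unset Strict Implicit.
Unset Printing Implicit Defensive.

Import Order.TTheory GRing.Theory Num.Theory.

Local Open Scope ring_scope.

(** A face of [D] with [a] vertices meets exactly [a] colour classes, so it
    extends by any subset of the remaining [s - a] new vertices. Hence
    [f_{i-1}] of the coloured complex is the sum over the faces [S] of [D] of
    ['C(s - #|S|, i - #|S|)], its facets have [s] vertices, and in [h_k] the
    alternating sum attached to each [S] collapses to [1] if [#|S| = k] and to
    [0] otherwise. *)

(** For [m <= n], both sides become [n!] after multiplication by [i! (m - i)! (n - m)!]; for
    [n < m], both vanish. *)
Lemma bin_trinomial (n m i : nat) : (i <= m)%N ->
  ('C(n, i) * 'C(n - i, m - i) = 'C(n, m) * 'C(m, i))%N.
Proof.
move=> im; have [mn|nm] := leqP m n; last first.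
  rewrite (bin_small nm) mul0n; have [ni|in_] := ltnP n i.
    by rewrite bin_small.
  by rewrite (@bin_small (n - i)) ?muln0 //; lia.
have in_ : (i <= n)%N := leq_trans im mn.
have min : (m - i <= n - i)%N by lia.
have pos : (0 < i`! * (m - i)`! * (n - m)`!)%N by rewrite !muln_gt0 !fact_gt0.
have e1 := bin_fact in_; have e2 := bin_fact min.
have e3 := bin_fact mn; have e4 := bin_fact im.
rewrite (_ : n - i - (m - i) = n - m)%N in e2; last by lia.
apply/eqP; rewrite -(eqn_pmul2r pos); apply/eqP.
transitivity n`!.
  by rewrite -e1 -e2; ring.
by rewrite -e3 -e4; ring.
Qed.

(** The trinomial identity pulls out ['C(n, m)] and leaves the binomial expansion of
    [(1 + -1) ^+ m]. *)
Lemma sum_sign_bin_trinomial (n m : nat) :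
  \sum_(i < m.+1) (-1) ^+ (m - i) * 'C(n - i, m - i)%:Z * 'C(n, i)%:Z
  = (m == 0)%:Z.
Proof.
transitivity ('C(n, m)%:Z * (1 + -1 : int) ^+ m).
  rewrite addrC exprDn mulr_sumr; apply: eq_bigr => i _.
  have im : (i <= m)%N by rewrite -ltnS.
  rewrite expr1n mulr1 -mulrA -PoszM mulnC bin_trinomial // PoszM.
  by rewrite mulrCA -mulr_natr natz.
by case: m => [|m]; rewrite ?bin0 ?expr0 ?mulr1 // subrr expr0n mulr0.
Qed.

(** This is the contribution to [h_k] of one face with [a] vertices. The guard [a <= i] matters: for
    [i < a] the truncated [i - a] would give ['C(s - a, 0) = 1]. *)
Lemma sum_sign_bin_shift (s a k : nat) :
  \sum_(0 <= i < k.+1) (-1) ^+ (k - i) * 'C(s - i, k - i)%:Z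
     * (if (a <= i)%N then 'C(s - a, i - a) else 0)%:Z
  = (a == k)%:Z.
Proof.
have [ak|ka] := leqP a k; last first.
  rewrite big_nat_cond big1 ?gtn_eqF // => i; rewrite andbT => ik.
  by rewrite ifF ?mulr0 //; lia.
rewrite (@big_cat_nat _ _ _ a) //=; last by lia.
rewrite big_nat_cond big1 ?add0r => [|i]; last first.
  by rewrite andbT => ik; rewrite ifF ?mulr0 //; lia.
(* Shifting the index by [a] gives the previous sum with [n = s - a] and [m = k - a]. *)
rewrite -{1}[a]add0n big_addn subSn // big_mkord.
rewrite (_ : (a == k) = (k - a == 0)%N) -?(sum_sign_bin_trinomial (s - a)); last by lia.
apply: eq_bigr => i _; rewrite leq_addl addnK.
have -> : (k - (i + a) = k - a - i)%N by lia.
by have -> : (s - (i + a) = s - a - i)%N by lia.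
Qed.

Section ComplexDimension.
Variables (V : finType) (D : simplicial_complex V).

Lemma face_dim_le_complex_dim (F : {set V}) :
  F \in faces D -> face_dim F <= complex_dim D.
Proof. by move=> FD; apply: le_bigmax_cond. Qed.

Lemma complex_dim_le (n : nat) :
  (forall F, F \in faces D -> (#|F| <= n)%N) -> complex_dim D <= n%:Z - 1.
Proof.
move=> Dn; apply/bigmax_leP; split=> [|F /Dn]; first by lia.
by rewrite /face_dim; lia.
Qed.

Lemma complex_dim_ge : -1 <= complex_dim D.
Proof.
apply: le_trans (face_dim_le_complex_dim (faces_set0 D)).
by rewrite /face_dim cards0.
Qed.

Lemma fnum_card (i : nat) :
  fnum D (i%:Z - 1) = #|[set F in faces D | #|F| == i]|.
Proof. by apply: eq_card => F; rewrite !inE /face_dim; lia. Qed.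

Lemma fnum_gt_complex_dim (i : nat) :
  complex_dim D + 1 < i%:Z -> fnum D (i%:Z - 1) = 0.
Proof.
move=> di; rewrite fnum_card; apply/eqP; rewrite cards_eq0 -subset0.
apply/subsetP => F; rewrite inE => /andP[/face_dim_le_complex_dim].
by rewrite /face_dim; lia.
Qed.

End ComplexDimension.

Section ColourComplex.
Variables (V : finType) (D : simplicial_complex V) (s : nat).
Variable chi : 'I_s -> {set V}.

Definition free_colours (S : {set V}) : {set 'I_s} :=
  [set j | S :&: chi j == set0].

Definition join_sets (S : {set V}) (T : {set 'I_s}) : {set V + 'I_s} :=
  (inl @: S) :|: (inr @: T).

Lemma preim_inl_join_sets S T : inl @^-1: join_sets S T = S.
Proof.
apply/setP=> x; rewrite !inE (mem_imset _ _ inl_inj).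
by case: imsetP => [[]|] //; rewrite orbF.
Qed.

Lemma preim_inr_join_sets S T : inr @^-1: join_sets S T = T.
Proof.
apply/setP=> x; rewrite !inE (mem_imset _ _ inr_inj).
by case: imsetP => [[]|].
Qed.

Lemma join_sets_preim (F : {set V + 'I_s}) :
  join_sets (inl @^-1: F) (inr @^-1: F) = F.
Proof.
apply/setP=> -[x|x]; rewrite inE ?(mem_imset _ _ inl_inj) ?(mem_imset _ _ inr_inj) inE.
  by case: imsetP => [[]|] //; rewrite orbF.
by case: imsetP => [[]|].
Qed.

Lemma card_join_sets S T : #|join_sets S T| = (#|S| + #|T|)%N.
Proof.
rewrite cardsU (card_imset _ inl_inj) (card_imset _ inr_inj).
rewrite (_ : _ :&: _ = set0) ?cards0 ?subn0 //.
apply/eqP; rewrite -subset0; apply/subsetP => x /setIP[/imsetP[y _ ->]].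
by case/imsetP.
Qed.

Lemma join_sets_colour_faces S T :
  (join_sets S T \in colour_faces D chi)
  = (S \in faces D) && (T \subset free_colours S).
Proof.
apply/imset2P/andP => [[S' T' S'D]|[SD /subsetP TS]].
  rewrite inE => /forall_inP T'S' e.
  rewrite -(preim_inl_join_sets S T) -{2}(preim_inr_join_sets S T) e.
  rewrite -/(join_sets S' T') preim_inl_join_sets preim_inr_join_sets.
  by split=> //; apply/subsetP => j /T'S'; rewrite inE.
by exists S T => //; rewrite inE; apply/forall_inP => j /TS; rewrite inE.
Qed.

Hypothesis hchi : colouring D chi.

(** A colouring constrains facets only; every face lies in one. *)
Lemma card_face_colour (S : {set V}) (j : 'I_s) :
  S \in faces D -> (#|S :&: chi j| <= 1)%N.
Proof.
case: hchi => _ _ chi1 SD; have [F facetF SF] := maxset_exists SD.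
exact: leq_trans (subset_leq_card (setSI _ SF)) (chi1 F j facetF).
Qed.

Lemma card_free_colours (S : {set V}) :
  S \in faces D -> (#|S| + #|free_colours S|)%N = s.
Proof.
case: (hchi) => chiT chiI _ SD.
have -> : #|S| = (\sum_(j < s) #|S :&: chi j|)%N.
  transitivity (\sum_(x in \bigcup_(j < s) chi j) (x \in S))%N.
    by rewrite chiT -big_mkcondr -sum1_card; apply: eq_bigl => x; rewrite inE.
  rewrite partition_disjoint_bigcup //; apply: eq_bigr => j _.
  by rewrite -big_mkcondr -sum1_card; apply: eq_bigl => x; rewrite inE andbC.
(* Each colour contributes exactly 1: either [S] meets its class in a single vertex, or the colour
   is free. *)
rewrite -sum1_card [X in (_ + X)%N]big_mkcond -big_split /= -[RHS]card_ord -sum1_card.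
apply: eq_bigr => j _; have := card_face_colour j SD.
by rewrite inE -cards_eq0; case: #|_| => [|[]].
Qed.

Lemma card_colour_faces (i : nat) :
  #|[set F in colour_faces D chi | #|F| == i]|
  = (\sum_(S in faces D) if (#|S| <= i)%N then 'C(s - #|S|, i - #|S|) else 0)%N.
Proof.
rewrite -sum1_card.
(* Faces are sorted by their part [S] in [V]; over [S], they correspond to the sets of [i - #|S|]
   free colours. *)
rewrite (partition_big (fun F : {set V + 'I_s} => inl @^-1: F) (mem (faces D))) /=.
  apply: eq_bigr => S SD.
  transitivity #|[set T : {set 'I_s} | T \subset free_colours S &
                   (#|S| + #|T|)%N == i]|.
    rewrite -sum1_card (reindex_onto (join_sets S) (fun F => inr @^-1: F)) /=.
      apply: eq_bigl => T; rewrite !inE join_sets_colour_faces SD.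
      by rewrite preim_inl_join_sets preim_inr_join_sets card_join_sets !eqxx !andbT.
    by move=> F /andP[_ /eqP <-]; rewrite join_sets_preim.
  case: ifP => Si.
    rewrite -(_ : #|free_colours S| = s - #|S|)%N; last first.
      by have := card_free_colours SD; lia.
    by rewrite -cards_draws; apply: eq_card => T; rewrite !inE; congr (_ && _); lia.
  apply: eq_card0 => T; rewrite !inE; apply/negbTE; rewrite negb_and; lia.
move=> F; rewrite inE -{1}[F]join_sets_preim join_sets_colour_faces.
by case/andP=> /andP[].
Qed.

Lemma complex_dim_colour_complex : complex_dim (colour_complex D chi) = s%:Z - 1.
Proof.
apply/eqP; rewrite eq_le complex_dim_le => [/=|F /=].
  (* The lower bound comes from the set of all [y_j], a face with [s] vertices since [set0] meets no
     class. *)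
  have T0 : join_sets set0 setT \in faces (colour_complex D chi).
    rewrite /= join_sets_colour_faces faces_set0.
    by apply/subsetP => j _; rewrite inE set0I.
  have := face_dim_le_complex_dim T0.
  by rewrite /face_dim card_join_sets cards0 cardsT card_ord.
rewrite -{1 2}[F]join_sets_preim join_sets_colour_faces card_join_sets.
case/andP=> SD /subset_leq_card; have := card_free_colours SD; lia.
Qed.

Lemma hnum_colour_complex (k : nat) :
  hnum (colour_complex D chi) k = (fnum D (k%:Z - 1))%:Z.
Proof.
rewrite /hnum complex_dim_colour_complex subrK absz_nat.
under eq_bigr => i _ do rewrite fnum_card /= card_colour_faces
  (big_morph Posz PoszD (erefl 0%:Z)) mulr_sumr.
(* With the sum over faces [S] outermost, the inner alternating sum is the indicator of
   [#|S| = k]. *)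
rewrite exchange_big /= fnum_card -sum1_card (big_morph Posz PoszD (erefl 0%:Z)).
rewrite big_mkcond [RHS]big_mkcond; apply: eq_bigr => S _; rewrite inE.
case: (S \in faces D) => //=.
by rewrite sum_sign_bin_shift; case: eqP.
Qed.

End ColourComplex.

Theorem mainTheorem5 (V : finType) (D : simplicial_complex V) (s : nat)
    (chi : 'I_s -> {set V}) (hchi : colouring D chi)
    (d : int) (hd : complex_dim D = d) :
  [/\ exists m : nat, hvector (colour_complex D chi) = fvector D ++ nseq m 0,
      forall i : nat, i%:Z <= d + 1 ->
        hnum (colour_complex D chi) i = (fnum D (i%:Z - 1))%:Z
    & forall i : nat, d + 1 < i%:Z -> hnum (colour_complex D chi) i = 0].
Proof.
split=> [|i _|i di]; try by rewrite hnum_colour_complex.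
  have dge := complex_dim_ge D.
  have ds : complex_dim D <= s%:Z - 1.
    by apply: complex_dim_le => F FD; have := card_free_colours hchi FD; lia.
  rewrite /hvector /fvector complex_dim_colour_complex //.
  set n := absz (complex_dim D + 2).
  (* The $h$-vector has [s + 1] entries and the $f$-vector has [n], that is [d + 2]; by [ds] the
     subtraction is exact. *)
  exists (s.+1 - n)%N.
  apply: (@eq_from_nth _ 0) => [|i].
    by rewrite size_cat !size_mkseq size_nseq /n; lia.
  rewrite size_mkseq => im; rewrite nth_mkseq // nth_cat size_mkseq.
  rewrite hnum_colour_complex //; case: ltnP => ni; first by rewrite nth_mkseq.
  (* In the padding, [i >= n] means [i > d + 1], so no face has [i] vertices. *)
  by rewrite nth_nseq if_same fnum_gt_complex_dim //; rewrite /n in ni; lia.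
by rewrite hnum_colour_complex // fnum_gt_complex_dim // hd.
Qed.
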